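(* Let $n\ge 1$ be an integer, let $i_1,\dots,i_n$ be independent real random variables with $E(1+i_l)=1+j$ and $Var(1+i_l)=s^2$ for every $l$, where $j\in\mathbb{R}$, $j\ne-1$, and let $1\le k\le n$. Let $u>-1$ be real with $u\ne j$, and let $t,h,w$ be defined by $1+u=(1+j)(1+t)$, $1+f=(1+u)^2(1+h)$ and $1+f=(1+j)^2(1+t)(1+w)$. Let $C_k$ be the final value of the annuity-due with $k$ annual payments $1,1+u,(1+u)^2,\dots,(1+u)^{k-1}$. Then $$E(C_k)=\frac{(1+j)^k\,\ddot s_{\overline{k}|t}}{1+t},$$ $$Var(C_k)=\frac{(1+u)^{2k}(2+t)\ddot s_{\overline{k}|h}-2(1+j)^{2k}(1+t)^k\ddot s_{\overline{k}|w}}{t}-\frac{(1+j)^{2k}\big(\ddot s_{\overline{2k}|t}-2\ddot s_{\overline{k}|t}\big)}{t(1+t)}.$$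
   Context: Final value: for annual payments $c_1,c_2,\dots$ the final value is defined by $C_1=(1+i_1)c_1$ and $C_k=(1+i_k)(C_{k-1}+c_k)$ for $k\ge 2$; here $c_l=(1+u)^{l-1}$. For a positive integer $k$ and real $x$: $\ddot s_{\overline{k}|x}=\sum_{l=1}^k(1+x)^{k+1-l}$. Constant: $f=2j+j^2+s^2$ (so $1+f=E[(1+i_l)^2]$). *)

(* Defs.v *)
From HB Require Import structures.
From mathcomp Require Import all_boot all_order all_algebra finmap.
From mathcomp Require Import all_classical all_reals all_analysis.

Set Implicit Arguments.
Unset Strict Implicit.
Unset Printing Implicit Defensive.

Import Order.TTheory GRing.Theory Num.Theory.
Import numFieldNormedType.Exports.

Local Open Scope classical_set_scope.
Local Open Scope ring_scope.

(* Mutual (not merely pairwise) independence of the subfamily of X indexed by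
   D; members of X outside D are unconstrained. *)
Definition independent_RVs (d : measure_display) (T : measurableType d)
    (R : realType) (P : probability T R) (I : choiceType) (D : set I)
    (X : I -> {RV P >-> R}) : Prop :=
  forall (J : {fset I}) (A : I -> set R),
    [set` J] `<=` D ->
    (forall l, l \in J -> measurable (A l)) ->
    P (\bigcap_(l in [set` J]) (X l @^-1` A l)) =
    (\prod_(l <- J) P (X l @^-1` A l))%E.

(* i and c are indexed from 1: i l is the interest rate of year l, and c l the
   payment made at the beginning of year l.  The value C_0 = 0 is a convention
   that folds the initial case C_1 = (1 + i_1) c_1 into the recursion. *)
Fixpoint final_value (R : pzRingType) (i c : nat -> R) (k : nat) : R :=
  if k is k'.+1 then (1 + i k) * (final_value i c k' + c k) else 0.

Lemma final_value1 (R : pzRingType) (i c : nat -> R) :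
  final_value i c 1 = (1 + i 1%N) * c 1%N.
Proof. by rewrite /= add0r. Qed.

Lemma final_valueS (R : pzRingType) (i c : nat -> R) (k : nat) : (2 <= k)%N ->
  final_value i c k = (1 + i k) * (final_value i c k.-1 + c k).
Proof. by case: k. Qed.

(* Final value of an annuity-due of k unit payments at the rate x. *)
Definition sddot (R : pzRingType) (k : nat) (x : R) : R :=
  \sum_(1 <= l < k.+1) (1 + x) ^+ (k + 1 - l).

(* Main.v *)
(* With X_l = 1 + i_l one has C_(m+1) = X_(m+1) (C_m + c_(m+1)), and X_(m+1) is
   independent of C_m.  Hence the first two moments e_m, q_m of C_m satisfy
     e_(m+1) = (1 + j) (e_m + c_(m+1)),
     q_(m+1) = (1 + f) (q_m + 2 c_(m+1) e_m + c_(m+1)^2),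
   which are solved by e_m = (1 + j)^m ((1 + t)^m - 1) / t and by the first
   fraction of the variance formula; the second fraction is e_k^2. *)

Require Import Defs.
From HB Require Import structures.
From mathcomp Require Import all_boot all_order all_algebra finmap.
From mathcomp Require Import all_classical all_reals all_analysis.
From mathcomp Require Import measurable_realfun ring.

Set Implicit Arguments.
Unset Strict Implicit.
Unset Printing Implicit Defensive.

Import Order.TTheory GRing.Theory Num.Theory.
Import numFieldNormedType.Exports.

Local Open Scope classical_set_scope.
Local Open Scope ring_scope.

(** * Joint laws and products of independent variables *)

Section independence.
Context (R : realType) (d : measure_display) (T : measurableType d).
Variable P : probability T R.

(** Both sides are measures in [D] that agree on rectangles, so uniqueness of the product measure
    extends the factorization to all measurable [D]. The extra event [F] will carry the rates of
    later years. *)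
Lemma independent_pair_law (d1 d2 : measure_display)
    (T1 : measurableType d1) (T2 : measurableType d2)
    (X : {mfun T >-> T1}) (Y : {mfun T >-> T2}) (F : set T) :
    measurable F ->
    (forall A B, measurable A -> measurable B ->
      P ((X @^-1` A `&` Y @^-1` B) `&` F) =
      (P (X @^-1` A) * P (Y @^-1` B) * P F)%E) ->
  forall D : set (T1 * T2), measurable D ->
    P ((fun x => (X x, Y x)) @^-1` D `&` F) =
    ((distribution P X \x distribution P Y) D * P F)%E.
Proof.
move=> mF XYF D mD.
have PF0 : (0 <= fine (P F))%R by rewrite fine_ge0.
pose r : {nonneg R} := NngNum PF0.
have rE : (r%:num%:E = P F)%E by rewrite /= fineK// fin_num_measure.
have mXY : measurable_fun setT (fun x => (X x, Y x)).
  by apply/measurable_fun_pairP.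
pose PXY : {mfun T >-> (T1 * T2)%type} := mfun_Sub (mem_set mXY).
transitivity (pushforward (mrestr P mF) PXY D); first by [].
(* The factor [P F] is absorbed into the first marginal, so that the right-hand side is itself a
   product measure. *)
rewrite -(@product_measure_unique _ _ _ _ _
  (mscale r (distribution P X)) (distribution P Y)
  (pushforward (mrestr P mF) PXY))//.
  rewrite /product_measure1 ge0_integral_mscale//; first by rewrite rE muleC.
  exact: measurable_fun_xsection.
move=> A B mA mB; transitivity (P ((X @^-1` A `&` Y @^-1` B) `&` F)); first by [].
by rewrite XYF// [LHS]muleC muleA -[X in (X * _ * _)%E]rE.
Qed.

(** The joint law is the product of the marginals: Tonelli applied to the absolute value gives
    integrability of the product, and Fubini then factors the integral. *)
Lemma expectation_prod_independent (X Y : {RV P >-> R}) :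
    (forall A B : set R, measurable A -> measurable B ->
      P (X @^-1` A `&` Y @^-1` B) = (P (X @^-1` A) * P (Y @^-1` B))%E) ->
    (X : T -> R) \in Lfun P 1 -> (Y : T -> R) \in Lfun P 1 ->
  (X \* Y)%R \in Lfun P 1 /\ ('E_P[X \* Y] = 'E_P[X] * 'E_P[Y])%E.
Proof.
move=> XY /Lfun1_integrable iX /Lfun1_integrable iY.
have mXY : measurable_fun setT (fun x => (X x, Y x)).
  by apply/measurable_fun_pairP.
pose PXY : {mfun T >-> (R * R)%type} := mfun_Sub (mem_set mXY).
pose f : (R * R)%type -> \bar R := fun z => (z.1 * z.2)%:E.
have mf : measurable_fun [set: (R * R)%type] f.
  by apply/measurable_EFinP; apply: measurable_funM.
have law D : measurable D ->
    distribution P PXY D = (distribution P X \x distribution P Y)%E D.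
  move=> mD; rewrite -[RHS]mule1 -(probability_setT P).
  rewrite -independent_pair_law//; first by rewrite setIT.
  by move=> A B mA mB; rewrite setIT XY// probability_setT mule1.
have ge0_law (g : R * R -> \bar R) : measurable_fun [set: (R * R)%type] g ->
    (forall z, 0 <= g z)%E ->
  (\int[P]_x g (X x, Y x) =
   \int[distribution P X \x distribution P Y]_z g z)%E.
  move=> mg g0; rewrite -(@ge0_integral_distribution _ _ _ _ _ P PXY)//.
  by apply: eq_measure_integral => D mD _; apply: law.
have intX : (distribution P X).-integrable setT (EFin : R -> \bar R).
  by apply: integrable_pushforward.
have intY : (distribution P Y).-integrable setT (EFin : R -> \bar R).
  by apply: integrable_pushforward.
have ifprod : (distribution P X \x distribution P Y)%E.-integrable setT f.
  apply/integrable12ltyP => //.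
  under eq_integral.
    move=> x _; rewrite /f/=.
    under eq_integral do rewrite normrM EFinM.
    rewrite ge0_integralZl//; last exact/measurable_EFinP.
    over.
  rewrite ge0_integralZr//; [|by apply/measurable_EFinP|by apply: integral_ge0].
  by move/integrableP: intX => [_ ?]; move/integrableP: intY => [_ ?];
    rewrite lte_mul_pinfty// ?integral_ge0// ge0_fin_numE// integral_ge0.
have iP : P.-integrable setT (f \o PXY).
  apply/integrableP; split; first exact: measurableT_comp.
  rewrite (ge0_law (abse \o f)); first last.
  - by move=> z; exact: abse_ge0.
  - by apply: measurableT_comp; [exact: abse_measurable|exact: mf].
  by move/integrableP: ifprod => [].
split; first exact/Lfun1_integrable.
rewrite unlock; transitivity (\int[distribution P PXY]_z f z)%E.
  by rewrite integral_distribution.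
rewrite (eq_measure_integral (distribution P X \x distribution P Y)%E); last first.
  by move=> D mD _; apply: law.
rewrite -integral12_prod_meas1// /fubini_F.
under eq_integral.
  move=> x _; rewrite /f/=.
  under eq_integral do rewrite EFinM.
  (* The finite inner integral is written as a real constant so that it can leave the outer
     integral. *)
  rewrite integralZl// -[X in (_ * X)%E]fineK; last exact: integrable_fin_num.
  over.
rewrite integralZr// fineK; last exact: integrable_fin_num.
by rewrite !integral_distribution.
Qed.

End independence.

(** * Independence of the final value from later rates *)

Section final_value_independence.
Context (R : realType) (d : measure_display) (T : measurableType d).
Variables (P : probability T R) (i : nat -> {RV P >-> R}) (c : nat -> R).

Lemma measurable_final_value (m : nat) :
  measurable_fun setT (fun x => final_value (fun l => i l x) c m).
Proof.
elim: m => [|m IHm]; first exact: measurable_cst.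
apply: measurable_funM; first exact: measurable_funD.
by apply: measurable_funD => //; exact: measurable_cst.
Qed.

Definition final_value_RV (m : nat) : {RV P >-> R} :=
  mfun_Sub (mem_set (measurable_final_value m)).

(* Carrying an arbitrary event of the later years along makes independence
   provable by induction on m. *)
Lemma final_value_RV_independent_tail (n m : nat) (J : {fset nat})
    (A : nat -> set R) (B : set R) :
    independent_RVs [set l | (1 <= l <= n)%N] i ->
    (m <= n)%N -> [set` J] `<=` [set l | (m < l <= n)%N] ->
    (forall l, l \in J -> measurable (A l)) -> measurable B ->
  P (final_value_RV m @^-1` B `&` \bigcap_(l in [set` J]) (i l @^-1` A l)) =
  (P (final_value_RV m @^-1` B) *
   P (\bigcap_(l in [set` J]) (i l @^-1` A l)))%E.
Proof.
move=> indep.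
elim: m J A B => [|m IHm] J A B mn Jsub mA mB.
  (* [C_0] is constant, so its events are trivial. *)
  have -> : final_value_RV 0 @^-1` B = if (0 : R) \in B then setT else set0.
    exact: preimage_cst.
  case: ifP => _; last by rewrite set0I measure0 mul0e.
  by rewrite setTI probability_setT mul1e.
have mbigcap (J' : {fset nat}) (A' : nat -> set R) :
    (forall l, l \in J' -> measurable (A' l)) ->
    measurable (\bigcap_(l in [set` J']) (i l @^-1` A' l)).
  by move=> mA'; apply: fin_bigcap_measurable => // l Jl;
    apply: measurable_funPTI; exact: mA'.
have mnotJ : m.+1 \notin J by apply/negP => /Jsub /=; rewrite ltnn.
(* Year [m.+1] joins the later years [J']: the induction hypothesis splits off [C_m], and mutual
   independence of the rates then splits off year [m.+1]. This serves for [J' = J] and for empty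
   [J']. *)
have split_year (J' : {fset nat}) (A' : nat -> set R) (D : set R) :
    (J' `<=` J)%fset -> (forall l, l \in J' -> measurable (A' l)) ->
    measurable D ->
    forall E : set R, measurable E ->
    P ((final_value_RV m @^-1` E `&` i m.+1 @^-1` D) `&`
       \bigcap_(l in [set` J']) (i l @^-1` A' l)) =
    (P (final_value_RV m @^-1` E) * P (i m.+1 @^-1` D) *
     P (\bigcap_(l in [set` J']) (i l @^-1` A' l)))%E.
  move=> J'J mA' mD E mE.
  pose A'' l := if l == m.+1 then D else A' l.
  have mnotJ' : m.+1 \notin J' by apply: contra mnotJ; exact/fsubsetP.
  have A''E : \bigcap_(l in [set` J']) (i l @^-1` A'' l) =
      \bigcap_(l in [set` J']) (i l @^-1` A' l).
    apply: eq_bigcapr => l /= lJ'; rewrite /A''; case: eqP => // lm.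
    by rewrite -lm lJ' in mnotJ'.
  have J''E : \bigcap_(l in [set` (m.+1 |` J')%fset]) (i l @^-1` A'' l) =
      i m.+1 @^-1` D `&` \bigcap_(l in [set` J']) (i l @^-1` A' l).
    by rewrite set_fsetU1 bigcap_setU1 {1}/A'' eqxx A''E.
  have mA'' l : l \in (m.+1 |` J')%fset -> measurable (A'' l).
    rewrite /A'' in_fset1U; case: eqP => //= _; exact: mA'.
  have J''sub : [set` (m.+1 |` J')%fset] `<=` [set l | (m < l <= n)%N].
    move=> l /=; rewrite in_fset1U => /orP[/eqP -> | /(fsubsetP J'J) /Jsub /=].
      by rewrite ltnSn.
    by case/andP => /ltnW -> ->.
  rewrite -setIA -J''E IHm//; last exact: ltnW.
  rewrite -muleA; congr (_ * _)%E.
  have sub1 (J0 : {fset nat}) : [set` J0] `<=` [set l | (m < l <= n)%N] ->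
      [set` J0] `<=` [set l | (1 <= l <= n)%N].
    move=> h l /h /= /andP[ml ->]; rewrite andbT; exact: leq_ltn_trans ml.
  rewrite indep//; last exact: sub1.
  rewrite big_fsetU1//= {1}/A'' eqxx; congr (_ * _)%E.
  rewrite indep//; last first.
    by apply: sub1 => l /= lJ'; apply: J''sub; rewrite /= in_fset1U lJ' orbT.
  rewrite !big_seq; apply: eq_bigr => l lJ'; rewrite /A''; case: eqP => // lm.
  by rewrite -lm lJ' in mnotJ'.
(* One step of the recursion, as a function of the pair of [C_m] and the rate of year [m.+1]. *)
pose phi (z : R * R) : R := (1 + z.2) * (z.1 + c m.+1).
have mphi : measurable_fun [set: (R * R)%type] phi.
  by apply: measurable_funM; apply: measurable_funD.
have mD : measurable (phi @^-1` B) by rewrite -[X in measurable X]setTI; exact: mphi.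
have -> : final_value_RV m.+1 @^-1` B =
  (fun x => (final_value_RV m x, i m.+1 x)) @^-1` (phi @^-1` B) by [].
rewrite independent_pair_law//; [|exact: mbigcap|]; last first.
  by move=> E D mE mD'; apply: split_year.
congr (_ * _)%E.
(* With no later years and [F = setT], the pair law identifies the remaining product measure with
   the probability that [C_(m+1)] lies in [B]. *)
have unconditional (E D : set R) : measurable E -> measurable D ->
    P ((final_value_RV m @^-1` E `&` i m.+1 @^-1` D) `&` setT) =
    (P (final_value_RV m @^-1` E) * P (i m.+1 @^-1` D) * P setT)%E.
  move=> mE mD'.
  by have := split_year fset0 (fun=> setT) D (fsub0set J) _ mD' E mE;
    rewrite set_fset0 bigcap_set0; apply.
have := independent_pair_law measurableT unconditional mD.
by rewrite setIT probability_setT mule1 => ->.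
Qed.

Lemma final_value_RV_independent (n m : nat) (A B : set R) :
    independent_RVs [set l | (1 <= l <= n)%N] i ->
    (m < n)%N -> measurable A -> measurable B ->
  P (final_value_RV m @^-1` A `&` i m.+1 @^-1` B) =
  (P (final_value_RV m @^-1` A) * P (i m.+1 @^-1` B))%E.
Proof.
move=> indep mn mA mB.
have := @final_value_RV_independent_tail n m [fset m.+1]%fset (fun=> B) A
  indep (ltnW mn).
rewrite set_fset1 bigcap_set1; apply => //.
by move=> _ /= ->; rewrite ltnSn mn.
Qed.

End final_value_independence.

(** * Calculus of first and second moments *)

Section moments.
Context (R : realType) (d : measure_display) (T : measurableType d).
Variable P : probability T R.
Implicit Types X Y : {RV P >-> R}.

(** The raw second moment is tracked instead of the variance because it is multiplicative under
    independence; integrability is bundled in for the linearity and product rules. *)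
Definition has_moments (X : T -> R) (a b : R) :=
  [/\ X \in Lfun P 1, (X \* X)%R \in Lfun P 1,
      'E_P[X] = a%:E & 'E_P[X \* X] = b%:E]%E.

(* Since +oo - oo = -oo, an integral that is undefined is never finite. *)
Lemma expectation_fin_num_Lfun1 (X : T -> R) :
  measurable_fun setT X -> ('E_P[X])%E \is a fin_num -> X \in Lfun P 1.
Proof.
move=> mX; rewrite unlock integralE => Xfin.
apply/Lfun1_integrable/integrableP; split; first exact/measurable_EFinP.
rewrite (_ : (fun x => _) = abse \o (EFin \o X))// fune_abse.
have mEX : measurable_fun setT (EFin \o X) by exact/measurable_EFinP.
rewrite ge0_integralD//; [|exact: measurable_funepos|exact: measurable_funeneg].
move: Xfin; rewrite fin_numB => /andP[pfin nfin].
by rewrite lte_add_pinfty// -ge0_fin_numE// integral_ge0.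
Qed.

Lemma variance_has_moments (X : T -> R) (a b : R) :
  has_moments X a b -> 'V_P[X]%E = (b - a ^+ 2)%:E.
Proof.
move=> [X1 XX1 EX EXX].
by rewrite /variance covarianceE// EX [X in (X - _)%E]EXX -EFinM -EFinB expr2.
Qed.

Lemma has_momentsD (X : T -> R) (a b c : R) :
  has_moments X a b ->
  has_moments (X \+ cst c)%R (a + c) (b + 2 * c * a + c ^+ 2).
Proof.
move=> [X1 XX1 EX EXX].
have XcE : ((X \+ cst c) \* (X \+ cst c) =
    X \* X \+ (2 * c) \o* X \+ cst (c ^+ 2))%R.
  by apply/funext => x /=; ring.
have c1 (e : R) : cst e \in Lfun P 1 by exact: Lfun_cst.
have cX1 : ((2 * c) \o* X)%R \in Lfun P 1 by exact: Lfun_scale.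
split.
- exact: rpredD.
- by rewrite XcE; do 2 apply: rpredD => //.
- by rewrite expectationD// EX expectation_cst.
- rewrite XcE expectationD//; last exact: rpredD.
  by rewrite expectationD// expectationZl// EX expectation_cst EXX.
Qed.

(** Finite mean and variance force [X] and the squared centred variable to be integrable; the
    centred variable has moments [0] and [v], and shifting it back by [a] gives the claim. *)
Lemma has_moments_variance (X : T -> R) (a v : R) :
    measurable_fun setT X -> 'E_P[X]%E = a%:E -> 'V_P[X]%E = v%:E ->
  has_moments X a (v + a ^+ 2).
Proof.
move=> mX EX; rewrite /variance unlock EX /= => VX.
pose Y : T -> R := (X \- cst a)%R.
have mY : measurable_fun setT Y by exact: measurable_funB.
have EYY : ('E_P[Y \* Y] = v%:E)%E by exact: VX.
have X1 : X \in Lfun P 1 by apply: expectation_fin_num_Lfun1; rewrite ?EX.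
have YY1 : (Y \* Y)%R \in Lfun P 1.
  by apply: expectation_fin_num_Lfun1; [exact: measurable_funM|rewrite EYY].
have Y1 : Y \in Lfun P 1 by apply: rpredB => //; exact: Lfun_cst.
have EY : ('E_P[Y] = 0%:E)%E.
  by rewrite expectationB ?Lfun_cst// EX expectation_cst -EFinB subrr.
have [] := @has_momentsD Y 0 v a (And4 Y1 YY1 EY EYY).
have -> : (Y \+ cst a = X)%R by apply/funext => x /=; rewrite subrK.
by rewrite add0r mulr0 addr0.
Qed.

(** Squares of independent variables are independent, so the product rule applies once to the
    variables and once to their squares. *)
Lemma has_momentsM X Y (a b a' b' : R) :
    (forall A B : set R, measurable A -> measurable B ->
      P (X @^-1` A `&` Y @^-1` B) = (P (X @^-1` A) * P (Y @^-1` B))%E) ->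
    has_moments X a b -> has_moments Y a' b' ->
  has_moments (X \* Y)%R (a * a') (b * b').
Proof.
move=> XY [X1 XX1 EX EXX] [Y1 YY1 EY EYY].
have mXX : measurable_fun setT (X \* X)%R by exact: measurable_funM.
have mYY : measurable_fun setT (Y \* Y)%R by exact: measurable_funM.
have [XY1 EXY] := expectation_prod_independent XY X1 Y1.
have msqr (B : set R) : measurable B -> measurable [set r : R | B (r * r)].
  move=> mB; rewrite -[X in measurable X]setTI.
  by apply: (@measurable_funM _ _ R setT id id).
have XXYY (A B : set R) : measurable A -> measurable B ->
    P ((X \* X)%R @^-1` A `&` (Y \* Y)%R @^-1` B) =
    (P ((X \* X)%R @^-1` A) * P ((Y \* Y)%R @^-1` B))%E.
  by move=> mA mB; exact: XY (msqr _ mA) (msqr _ mB).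
have [XXYY1 EXXYY] := @expectation_prod_independent _ _ _ P
  (mfun_Sub (mem_set mXX)) (mfun_Sub (mem_set mYY)) XXYY XX1 YY1.
have XYE : ((X \* Y) \* (X \* Y) = (X \* X) \* (Y \* Y))%R.
  by apply/funext => x /=; ring.
split=> //; first by rewrite XYE.
  by rewrite EXY EX EY.
by rewrite XYE EXXYY [in LHS]/= EXX EYY.
Qed.
End moments.

(** * Moment recursions for the final value *)

Section final_value_moments.
Context (R : realType) (d : measure_display) (T : measurableType d).
Variables (P : probability T R) (i : nat -> {RV P >-> R}) (c : nat -> R).

(** Each year is a shift by the payment followed by multiplication by an independent factor. Keeping
    [e] and [q] abstract leaves the closed forms to be checked by algebra alone. *)
Lemma final_value_has_moments (n m : nat) (a b : R) (e q : nat -> R) :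
    independent_RVs [set l | (1 <= l <= n)%N] i ->
    (forall l, (1 <= l <= n)%N -> has_moments P (fun x => 1 + i l x) a b) ->
    e 0 = 0 -> (forall l, e l.+1 = a * (e l + c l.+1)) ->
    q 0 = 0 ->
    (forall l, q l.+1 = b * (q l + 2 * c l.+1 * e l + c l.+1 ^+ 2)) ->
    (m <= n)%N ->
  has_moments P (final_value_RV i c m) (e m) (q m).
Proof.
move=> indep mom_i e0 eS q0 qS; elim: m => [_|m IHm mn].
  rewrite e0 q0.
  have -> : (final_value_RV i c 0 : T -> R) = cst 0 by [].
  have E0 : (cst 0 \* cst 0 = cst 0 :> (T -> R))%R.
    by apply/funext => x /=; rewrite mul0r.
  by split; rewrite ?E0 ?Lfun_cst// expectation_cst.
have mX : measurable_fun setT (final_value_RV i c m \+ cst (c m.+1))%R.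
  exact: measurable_funD.
have mY : measurable_fun setT (fun x => 1 + i m.+1 x)%R.
  exact: measurable_funD.
pose X : {RV P >-> R} := mfun_Sub (mem_set mX).
pose Y : {RV P >-> R} := mfun_Sub (mem_set mY).
have madd (r : R) (B : set R) : measurable B -> measurable [set z | B (r + z)].
  move=> mB; rewrite -[X in measurable X]setTI.
  by apply: (@measurable_funD _ _ R setT (cst r) id).
(* [X] and [Y] are translates of [C_m] and of the next rate, so their events are events of those two
   variables. *)
have YX (A B : set R) : measurable A -> measurable B ->
    P (Y @^-1` A `&` X @^-1` B) = (P (Y @^-1` A) * P (X @^-1` B))%E.
  move=> mA mB; rewrite setIC muleC.
  have -> : X @^-1` B = final_value_RV i c m @^-1` [set z | B (c m.+1 + z)].
    by apply/funext => x; rewrite /preimage /= addrC.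
  exact: final_value_RV_independent indep mn (madd _ _ mB) (madd 1 _ mA).
have := has_momentsM YX (mom_i m.+1 mn) (has_momentsD (c m.+1) (IHm (ltnW mn))).
by rewrite -eS -qS.
Qed.
End final_value_moments.

(** * Recursion and closed form of the annuity value *)

Section sddot.
Variable R : realType.
Implicit Types (k : nat) (x : R).

Lemma sddot0 x : sddot 0 x = 0.
Proof. by rewrite /sddot big_geq. Qed.

Lemma sddotS k x : sddot k.+1 x = (1 + x) * (sddot k x + 1).
Proof.
rewrite /sddot big_nat_recr//= addn1 subSnn expr1 mulrDr mulr1 big_distrr/=.
congr (_ + _); apply: eq_big_nat => l /andP[_ lk].
by rewrite -exprS -subSn ?addn1 ?ltnS ?(ltnW lk)// ltnW.
Qed.

(** The geometric sum, stated without division so that it holds for every [x]. *)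
Lemma mul_sddot k x : x * sddot k x = (1 + x) * ((1 + x) ^+ k - 1).
Proof.
elim: k => [|k IHk]; first by rewrite sddot0 expr0 subrr !mulr0.
by rewrite sddotS mulrCA mulrDr IHk exprS; ring.
Qed.
End sddot.

Theorem corollary3p5 (R : realType) (d : measure_display)
    (T : measurableType d) (P : probability T R)
    (n k : nat) (i : nat -> {RV P >-> R}) (j s f u t h w : R)
    (n_ge1 : (1 <= n)%N)
    (indep_i : independent_RVs [set l : nat | (1 <= l <= n)%N] i)
    (mean_i : forall l : nat, (1 <= l <= n)%N ->
      ('E_P[fun x : T => (1 + i l x)%R] = (1 + j)%:E)%E)
    (var_i : forall l : nat, (1 <= l <= n)%N ->
      ('V_P[fun x : T => (1 + i l x)%R] = (s ^+ 2)%:E)%E)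
    (j_neqN1 : j != -1)
    (k_range : (1 <= k <= n)%N)
    (u_gtN1 : -1 < u)
    (u_neq_j : u != j)
    (f_def : f = 2 * j + j ^+ 2 + s ^+ 2)
    (t_def : 1 + u = (1 + j) * (1 + t))
    (h_def : 1 + f = (1 + u) ^+ 2 * (1 + h))
    (w_def : 1 + f = (1 + j) ^+ 2 * (1 + t) * (1 + w)) :
  let C (x : T) : R :=
    final_value (fun l => i l x) (fun l => (1 + u) ^+ (l - 1)) k in
  ('E_P[C] = ((1 + j) ^+ k * sddot k t / (1 + t))%:E)%E /\
  ('V_P[C] =
    (((1 + u) ^+ (2 * k) * (2 + t) * sddot k h
       - 2 * (1 + j) ^+ (2 * k) * (1 + t) ^+ k * sddot k w) / t
     - (1 + j) ^+ (2 * k) * (sddot (2 * k) t - 2 * sddot k t)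
       / (t * (1 + t)))%:E)%E.
Proof.
have jp0 : 1 + j != 0 by rewrite addrC -(opprK 1) subr_eq0.
have up0 : 1 + u != 0 by rewrite gt_eqF// -ltrBlDl sub0r.
have tp0 : 1 + t != 0.
  by apply: contra_neq up0 => t0; rewrite t_def t0 mulr0.
have t0 : t != 0.
  by apply: contra_neq u_neq_j => t0; move: t_def; rewrite t0 addr0 mulr1 => /addrI.
pose c l : R := (1 + u) ^+ (l - 1).
pose e m : R := (1 + j) ^+ m * sddot m t / (1 + t).
pose q m : R := ((1 + u) ^+ (2 * m) * (2 + t) * sddot m h
       - 2 * (1 + j) ^+ (2 * m) * (1 + t) ^+ m * sddot m w) / t.
have eE m : e m = (1 + j) ^+ m * ((1 + t) ^+ m - 1) / t.
  have -> : (1 + t) ^+ m - 1 = t * sddot m t / (1 + t).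
    by rewrite mul_sddot; field.
  by rewrite /e; field; rewrite t0 tp0.
have ut m : (1 + u) ^+ m = (1 + j) ^+ m * (1 + t) ^+ m.
  by rewrite t_def exprMn.
have momC : has_moments P (final_value_RV i c k) (e k) (q k).
  have /andP[_ kn] := k_range.
  apply: (final_value_has_moments indep_i _ _ _ _ _ kn (a := 1 + j) (b := 1 + f)).
  - move=> l ln; rewrite f_def.
    (* Thus [1 + f] is variance plus squared mean, the second moment of each [1 + i l]. *)
    have -> : 1 + (2 * j + j ^+ 2 + s ^+ 2) = s ^+ 2 + (1 + j) ^+ 2 by ring.
    by apply: has_moments_variance; [exact: measurable_funD|exact: mean_i|exact: var_i].
  - by rewrite /e sddot0 mulr0 mul0r.
  - by move=> m; rewrite !eE /c subn1/= ut !exprS; field.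
  - by rewrite /q !sddot0 !mulr0 subrr mul0r.
  - move=> m; rewrite {1}/q !sddotS eE /c subn1/=.
    (* The definitions of [h] and [w] are exactly what makes each of the two terms of [q] release a
       common factor [1 + f]. *)
    have -> : (1 + u) ^+ (2 * m.+1) * (2 + t) * ((1 + h) * (sddot m h + 1)) =
        (1 + f) * ((1 + u) ^+ (2 * m) * (2 + t) * (sddot m h + 1)).
      by rewrite h_def mulnS exprD; ring.
    have -> : 2 * (1 + j) ^+ (2 * m.+1) * (1 + t) ^+ m.+1 *
          ((1 + w) * (sddot m w + 1)) =
        (1 + f) * (2 * (1 + j) ^+ (2 * m) * (1 + t) ^+ m * (sddot m w + 1)).
      by rewrite w_def mulnS exprD !exprS; ring.
    (* The annuities at [h] and [w] cancel; the added ones produce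
       [2 * c m.+1 * e m + c m.+1 ^+ 2]. *)
    rewrite /q !(mulnC 2) !exprM !ut; field.
    exact: t0.
split.
  by case: momC.
rewrite (variance_has_moments momC); congr _%:E.
rewrite /q eE; congr (_ - _).
(* In closed form [sddot (2 * k) t - 2 * sddot k t] is [(1 + t) / t] times the square of
   [(1 + t) ^+ k - 1], which gives [e k ^+ 2]. *)
have mulE l : sddot l t = (1 + t) * ((1 + t) ^+ l - 1) / t.
  by rewrite -mul_sddot; field.
rewrite !mulE !(mulnC 2) !exprM; field.
by rewrite t0 tp0.
Qed.
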